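(* Let $(d,p,m)$ be one of $$(3,3,4),\ (4,4,4),\ (5,4,4),\ (6,5,4),\ (7,6,5),\ (8,6,5),\ (9,7,5),\ (10,8,5),\ (11,11,6),$$ and let $a=\frac{6(p-1)}{d-1}-1$. Then there exist nonnegative rational numbers $\lambda_1,\dots,\lambda_6$ with $\sum_{i=1}^6\lambda_i=1$ such that \begin{align*} d!\int_{T^d}f(x,1-|x|_1)\,dx={}&\lambda_1 M_f\big(\tfrac1{d+1}v_{d+1}\big)+\lambda_2M_f(v_1)+\lambda_3M_f\big(\tfrac12v_2\big)+\lambda_4M_f\big(\tfrac13v_3\big)\\ &+\lambda_5M_f\big(\tfrac1mv_m\big)+\lambda_6M_f\big(\tfrac1{a+p}u_{a,p}\big) \end{align*} for every homogeneous polynomial $f$ of degree $5$ in $d+1$ variables, which is a positive cubature rule of degree $5$ for the unit weight function on $T^d$. Moreover, for $(d,p,m)=(3,3,4)$ (where $a=5$) one may take $$\lambda_1=\tfrac{16}{105},\ \lambda_2=\tfrac1{70},\ \lambda_3=\tfrac4{35},\ \lambda_4=\tfrac{81}{350},\ \lambda_5=0,\ \lambda_6=\tfrac{256}{525},$$ and for $(d,p,m)=(11,11,6)$ (where $a=5$) one may take $$\lambda_1=0,\ \lambda_2=\tfrac1{6825},\ \lambda_3=\tfrac{11}{1365},\ \lambda_4=0,\ \lambda_5=\tfrac{891}{2275},\ \lambda_6=\tfrac{4096}{6825}.$$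
   Context: $T^d=\{x\in\mathbb{R}^d:x_i\ge0,\ |x|_1\le1\}$, $|x|_1=x_1+\dots+x_d$. $v_k=(1,\dots,1,0,\dots,0)\in\mathbb{R}^{d+1}$ ($k$ ones), $u_{a,p}=(a,1,\dots,1,0,\dots,0)\in\mathbb{R}^{d+1}$ ($p$ ones after $a$). For $y\in\mathbb{R}^{d+1}$, $M_f(y)$ denotes the average of $f$ over the set of distinct points obtained from $y$ by permuting coordinates. Orbits whose coefficient $\lambda_i$ vanishes are omitted from the rule. *)

(* Defs.v *)
From HB Require Import structures.
From mathcomp Require Import all_boot all_order all_algebra all_fingroup.
From mathcomp Require Import all_classical all_reals all_analysis.
(* The notations of mpoly clash with those of all_analysis. *)
From mathcomp.multinomials Require mpoly.
Import (canonicals, coercions, hints) mpoly.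

Set Implicit Arguments.
Unset Strict Implicit.
Unset Printing Implicit Defensive.

Import Order.TTheory GRing.Theory Num.Theory.
Import numFieldNormedType.Exports.

Local Open Scope classical_set_scope.
Local Open Scope ring_scope.

Notation mpolynomial n R := (mpoly.mpoly n R).
Notation mpeval f x := (mpoly.meval (tnth x) f).
Notation homogeneous f t := (f \is mpoly.ishomog1 t (@mpoly.mdeg _)).
(* msize is the total degree plus one, and 0 for the zero polynomial. *)
Notation degree_le f t := (is_true (mpoly.msize f <= t.+1)%N).

Section LebesgueTuple.
Context (R : realType).

Definition tcons n (q : R * n.-tuple R) : n.+1.-tuple R :=
  [tuple of q.1 :: q.2].

Lemma measurable_tcons n : measurable_fun [set: R * n.-tuple R] (@tcons n).
Proof. exact: measurable_cons. Qed.

Section Step.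
Context n (mu : {measure set (n.-tuple R) -> \bar R}).

(* \x^ rather than \x: no sigma-finiteness is needed of its right factor. *)
Definition lebesgue_cons : set (n.+1.-tuple R) -> \bar R :=
  pushforward (lebesgue_measure \x^ mu)%E (@tcons n).

Let lebesgue_cons0 : lebesgue_cons set0 = 0%E.
Proof. by apply: measure0; exact: measurable_tcons. Qed.

Let lebesgue_cons_ge0 A : (0 <= lebesgue_cons A)%E.
Proof. by apply: measure_ge0; exact: measurable_tcons. Qed.

Let lebesgue_cons_sigma_additive : semi_sigma_additive lebesgue_cons.
Proof. by apply: measure_semi_sigma_additive; exact: measurable_tcons. Qed.

HB.instance Definition _ := isMeasure.Build _ _ _ lebesgue_cons
  lebesgue_cons0 lebesgue_cons_ge0 lebesgue_cons_sigma_additive.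

End Step.

(* Lebesgue measure on R^n with its product (Borel) sigma-algebra, as the
   iterated product of the one on R. *)
Fixpoint lebesgue_tuple n : {measure set (n.-tuple R) -> \bar R} :=
  if n is k.+1 then lebesgue_cons (lebesgue_tuple k) else \d_ [tuple].

Lemma lebesgue_tuple_box n (A : 'I_n -> set R) :
  (forall i, measurable (A i)) ->
  lebesgue_tuple n [set x | forall i, A i (tnth x i)] =
  (\prod_(i < n) lebesgue_measure (A i))%E.
Proof.
elim: n A => [|n IHn] A mA /=.
  by rewrite big_ord0 diracE mem_set//; case.
rewrite big_ord_recl -IHn; last by move=> i; exact: mA.
rewrite /lebesgue_cons /pushforward -product_measure2E//.
- congr product_measure2; apply/seteqP; split => -[x1 x] /= Ax.
    split; first by have := Ax ord0.
    by move=> i; have := Ax (lift ord0 i); rewrite tnthS.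
  by case: Ax => A0 As i; case: (unliftP ord0 i) => [j|] ->; rewrite ?tnthS.
- exact: mA.
rewrite [X in measurable X](_ : _ =
    \bigcap_(i in [set: 'I_n]) (@tnth n R ^~ i) @^-1` A (lift ord0 i)).
  apply: fin_bigcap_measurable => // i _.
  by rewrite -[X in measurable X]setTI; apply: measurable_tnth.
by apply/seteqP; split => [x h i _|x h i]; [exact: h | exact: (h i I)].
Qed.

End LebesgueTuple.

Section Cubature.
Context (R : realType) (d : nat).

(* A rule Q, given as its list of (weight, node) pairs, is a positive cubature
   rule of degree t for the weight function W on D if its nodes are distinct
   points of D, its weights are positive, and it integrates exactly every real
   polynomial in d variables of total degree at most t.  Stating exactness in
   \bar R includes the finiteness of the integral. *)
Definition positive_cubature (D : set (d.-tuple R)) (W : d.-tuple R -> R)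
    (t : nat) (Q : seq (R * d.-tuple R)) : Prop :=
  [/\ uniq [seq q.2 | q <- Q],
      forall q, q \in Q -> D q.2 /\ 0 < q.1
    & forall g : mpolynomial d R, degree_le g t ->
      (\int[@lebesgue_tuple R d]_(x in D) (mpeval g x * W x)%:E =
       (\sum_(q <- Q) q.1 * mpeval g q.2)%:E)%E].

End Cubature.

Section Orbits.
Context (R : realType) (n : nat).
Implicit Types (x y : n.-tuple R).

Definition perm_orbit y : seq (n.-tuple R) :=
  undup [seq [tuple tnth y (s i) | i < n] | s : 'S_n].

Definition orbit_mean (f : mpolynomial n R) y : R :=
  (\sum_(z <- perm_orbit y) mpeval f z) / (size (perm_orbit y))%:R.

Definition scalept (c : R) y : n.-tuple R := [tuple c * tnth y i | i < n].

Definition vpt (k : nat) : n.-tuple R := [tuple (i < k)%N%:R | i < n].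

Definition upt (a : R) (p : nat) : n.-tuple R :=
  [tuple if i == 0%N :> nat then a else (i <= p)%N%:R | i < n].

End Orbits.

Section SimplexRule.
Context (R : realType) (d : nat).

(* The sum of the coordinates, without absolute values: it is the l1 norm on
   the nonnegative orthant only. *)
Definition norm1 (x : d.-tuple R) : R := \sum_(i < d) tnth x i.

Definition simplex : set (d.-tuple R) :=
  [set x | (forall i, 0 <= tnth x i) /\ norm1 x <= 1].

(* (x, 1 - |x|_1) *)
Definition bary (x : d.-tuple R) : d.+1.-tuple R :=
  [tuple of rcons x (1 - norm1 x)].

(* The first d coordinates: the inverse of bary on the points of R^(d+1) whose
   coordinates sum to 1. *)
Definition unbary (z : d.+1.-tuple R) : d.-tuple R :=
  [tuple tnth z (widen_ord (leqnSn d) i) | i < d].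

Definition acoord (p : nat) : R := 6 * (p%:R - 1) / (d%:R - 1) - 1.

(* The weights and nodes on T^d encoded by
     d! \int f(x, 1 - |x|_1) dx = \sum_((l, y) <- ly) l * M_f(y),
   that is, after division by d!; orbits with l = 0 are omitted. *)
Definition simplex_rule (ly : seq (rat * d.+1.-tuple R)) :
    seq (R * d.-tuple R) :=
  flatten [seq [seq (ratr q.1 / (d`! * size (perm_orbit q.2))%:R, unbary z)
               | z <- perm_orbit q.2]
          | q <- ly & q.1 != 0].

Definition valid_weights (p m : nat) (a : R) (l1 l2 l3 l4 l5 l6 : rat) : Prop :=
  let y1 := scalept d.+1%:R^-1 (vpt R d.+1 d.+1) in
  let y2 := vpt R d.+1 1 in
  let y3 := scalept 2^-1 (vpt R d.+1 2) in
  let y4 := scalept 3^-1 (vpt R d.+1 3) in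
  let y5 := scalept m%:R^-1 (vpt R d.+1 m) in
  let y6 := scalept (a + p%:R)^-1 (upt d.+1 a p) in
  [/\ [&& 0 <= l1, 0 <= l2, 0 <= l3, 0 <= l4, 0 <= l5 & 0 <= l6],
      l1 + l2 + l3 + l4 + l5 + l6 = 1,
      forall f : mpolynomial d.+1 R, homogeneous f 5 ->
        (d`!%:R%:E * \int[@lebesgue_tuple R d]_(x in simplex)
                        (mpeval f (bary x))%:E =
         (ratr l1 * orbit_mean f y1 + ratr l2 * orbit_mean f y2 +
          ratr l3 * orbit_mean f y3 + ratr l4 * orbit_mean f y4 +
          ratr l5 * orbit_mean f y5 + ratr l6 * orbit_mean f y6)%:E)%E
    & positive_cubature simplex (fun=> 1) 5
        (simplex_rule [:: (l1, y1); (l2, y2); (l3, y3);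
                          (l4, y4); (l5, y5); (l6, y6)])].

End SimplexRule.

(* Main.v *)
From mathcomp Require Import all_fingroup.
Require Import Defs.
From mathcomp Require Import all_boot all_order all_algebra.
From mathcomp Require Import all_classical all_reals all_analysis.
From HB Require Import structures.
From mathcomp.multinomials Require mpoly.
Import (canonicals, coercions, hints) mpoly.
From mathcomp Require Import measurable_realfun zify ring lra.

Import Order.TTheory GRing.Theory Num.Theory.
Import numFieldNormedType.Exports.
Local Open Scope ring_scope.

(** Both sides of the rule are symmetric in the d + 1 barycentric coordinates.
    The simplex moments are the Dirichlet integrals m! / (d + |m|)!.  The mean
    of a monomial over the orbit of y is its mean over all permutations of the
    coordinates, which depends only on the exponents and is a polynomial in the
    power sums p_b of y: multiplying the mean of x^mu by p_b adds the exponent b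
    either at a new coordinate or on top of an old one, which gives a recursion
    on the number of variables.  All nodes satisfy p_1 = 1, so in degree 5 the
    identity reduces to seven linear equations for the weights, involving
    1, p_2, p_3, p_4, p_5, p_2^2 and p_2 p_3.  The rule integrates polynomials
    of degree at most 5 on the simplex after homogenization by the sum of the
    barycentric coordinates, and p_2 distinguishes the orbits of the nodes. *)

Set Implicit Arguments.
Unset Strict Implicit.
Unset Printing Implicit Defensive.

(** * Dirichlet integrals over the simplex *)

Section DirichletIntegral.
Context {R : realType}.
Local Open Scope classical_set_scope.

(** The cubes with sides [[-k, k]] exhaust the space and have finite measure by the product formula
    for boxes. This is what Tonelli's theorem requires. *)
Lemma sigma_finite_lebesgue_tuple n : sigma_finite setT (@lebesgue_tuple R n).
Proof.
pose B k : set (n.-tuple R) :=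
  [set x | forall i, `[- k%:R, k%:R]%classic (tnth x i)].
have mI k : measurable (`[- k%:R, k%:R]%classic : set R) by [].
exists B; last first.
  move=> k; split.
    rewrite [B k](_ : _ =
        \bigcap_(i in [set: 'I_n]) (@tnth n R ^~ i) @^-1` `[- k%:R, k%:R]).
      apply: fin_bigcap_measurable => // i _.
      by rewrite -[X in measurable X]setTI; apply: measurable_tnth.
    by apply/seteqP; split => [x h i _|x h i]; [exact: h | exact: (h i I)].
  rewrite /B (lebesgue_tuple_box (A := fun=> `[- k%:R, k%:R]%classic))//.
  rewrite big_const; elim: #|_| => [|j IHj] /=; first by rewrite ltry.
  apply: lte_mul_pinfty => //.
  rewrite lebesgue_measure_itv/=; case: ifP => _ //.
apply/esym; rewrite -subTset => x _.
(* The sum of the absolute values of the coordinates bounds each of them. *)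
pose k := Num.truncn (\sum_i `|tnth x i|).
exists k.+1 => // i /=.
rewrite in_itv/= -ler_norml ltW//.
apply: le_lt_trans (truncnS_gt _).
by rewrite (bigD1 i)//= lerDl sumr_ge0.
Qed.

(** Tonelli's theorem with the first coordinate integrated innermost. The two product constructions
    [\x^] and [\x] agree on rectangles, hence everywhere by sigma-finiteness. *)
Lemma integral_lebesgue_tupleS n (f : n.+1.-tuple R -> \bar R) :
  measurable_fun setT f -> (forall x, (0 <= f x)%E) ->
  (\int[@lebesgue_tuple R n.+1]_x f x =
   \int[@lebesgue_tuple R n]_x \int[lebesgue_measure]_t f (tcons (t, x)))%E.
Proof.
move=> mf f0.
have mC : measurable_fun [set: measurableTypeR R * n.-tuple R] (@tcons R n).
  exact: measurable_tcons.
pose mu := @lebesgue_tuple R n.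
have sfmu : sigma_finite setT mu := @sigma_finite_lebesgue_tuple n.
pose H2 := isSFinite.Build _ _ _ _ (sfinite_measure_sigma_finite sfmu).
pose H3 := isSigmaFinite.Build _ _ _ _ sfmu.
pose sf : {sigma_finite_measure set _ -> \bar R} :=
  HB.pack (Measure.sort mu) H2 H3.
pose nu : {measure set (measurableTypeR R * n.-tuple R) -> \bar R} :=
  (lebesgue_measure \x^ mu)%E.
have f0' : {in [set: n.+1.-tuple R], forall x, (0 <= f x)%E} by move=> x _.
have -> := @ge0_integral_pushforward _ _ _ _ _ _ mC nu _ _ measurableT mf f0'.
rewrite (eq_measure_integral (lebesgue_measure \x sf)%E); last first.
  move=> A mA _; apply/esym; apply: product_measure_unique => // A1 A2 mA1 mA2.
  exact: product_measure2E.
rewrite fubini_tonelli2//; first exact: measurableT_comp mf mC.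
by move=> x; exact: f0.
Qed.

Lemma integral_deriv_poly (p : {poly R}) (s : R) : 0 <= s ->
  (\int[lebesgue_measure]_(t in `[0%R, s]) ((deriv p).[t])%:E =
   (p.[s] - p.[0])%:E)%E.
Proof.
(* The fundamental theorem is applied on a nondegenerate interval, so [s = 0] is treated apart. *)
rewrite le_eqVlt => /predU1P[<-|s0].
  by rewrite set_itv1 integral_set1 subrr.
rewrite (@continuous_FTC2 R (horner (deriv p)) (horner p))//.
- exact/continuous_subspaceT/continuous_horner.
- split.
  + by move=> x _; exact: derivable_horner.
  + exact/cvg_at_right_filter/continuous_horner.
  + exact/cvg_at_left_filter/continuous_horner.
- by move=> x _; rewrite -derivE.
Qed.

(* Integrating by parts on primitives needs no integrability. *)
Lemma beta_primitive (a b : nat) (s : R) : exists q : {poly R},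
  deriv q = 'X^a * (s%:P - 'X) ^+ b /\
  q.[s] - q.[0] = (a`! * b`!)%:R / (a + b).+1`!%:R * s ^+ (a + b).+1.
Proof.
elim: b a => [|b IHb] a.
  exists (a.+1%:R^-1 *: 'X^(a.+1)); split.
    by rewrite derivZ derivXn -[X in _ *: X]scaler_nat scalerA mulVf ?scale1r
      ?mulr1.
  rewrite !hornerE/= expr0n/= ?(mulr0, subr0, addn0, muln1) factS natrM.
  have := fact_gt0 a; have : (a.+1%:R : R) != 0 by rewrite pnatr_eq0.
  rewrite -(ltr0n R) => ? /lt0r_neq0 ?.
  by field; apply/andP; split=> //; rewrite nat1r.
have [q [dq vq]] := IHb a.+1.
have a0 : (a.+1%:R : R) != 0 by rewrite pnatr_eq0.
(* The derivative of the product is [(a + 1) X^a (s - X)^(b + 1) - (b + 1) X^(a + 1) (s - X)^b]; the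
   term in [q] cancels the second summand. *)
exists ((a.+1%:R^-1)%:P * ('X^(a.+1) * (s%:P - 'X) ^+ b.+1 + (b.+1%:R)%:P * q)).
split.
  have k1 : (a.+1%:R^-1)%:P * a.+1%:R = 1 :> {poly R}.
    by rewrite -polyC_natr -polyCM mulVf.
  rewrite !(derivM, derivD, derivC, derivXn, deriv_exp, derivB, derivX) dq.
  rewrite !(mul0r, add0r) polyC_natr.
  rewrite derivN derivX mulN1r mulNrn mulrN mulrnAr mulr_natl addrNK.
  by rewrite mulrnAl -[X in _ * X]mulr_natl mulrA k1 mul1r.
(* The boundary product vanishes at both [0] and [s], as both its exponents are successors. *)
transitivity (a.+1%:R^-1 * (b.+1%:R * (q.[s] - q.[0]))).
  have e0 k : 0 ^+ k.+1 = 0 :> R by rewrite expr0n.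
  rewrite !(hornerM, hornerC, hornerD, hornerXn, horner_exp, hornerN, hornerX).
  by rewrite subrr !e0 !(mulr0, mul0r, add0r) -!mulrBr.
rewrite vq addSnnS [a.+1`!]factS [b.+1`!]factS !natrM.
rewrite !mulrA [_^-1 * b.+1%:R]mulrC -[b.+1%:R * _ * _]mulrA mulVf// mulr1.
by rewrite [b.+1%:R * a`!%:R]mulrC.
Qed.

Lemma integral_beta (a b : nat) (s : R) : 0 <= s ->
  (\int[lebesgue_measure]_(t in `[0%R, s]) (t ^+ a * (s - t) ^+ b)%:E =
   ((a`! * b`!)%:R / (a + b).+1`!%:R * s ^+ (a + b).+1)%:E)%E.
Proof.
move=> s0; have [q [dq <-]] := beta_primitive a b s.
rewrite -integral_deriv_poly// dq.
by apply: eq_integral => t _; rewrite !hornerE.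
Qed.

Lemma norm1_tcons n (t : R) (x : n.-tuple R) :
  norm1 (tcons (t, x)) = t + norm1 x.
Proof.
rewrite /norm1 big_ord_recl; congr (_ + _).
by apply: eq_bigr => i _; rewrite tnthS.
Qed.

(** Describes the fibres for the induction on the dimension: over a point of the lower simplex the
    first coordinate runs through a segment, and over any other point the fibre is empty. *)
Lemma simplex_tcons n (t : R) (x : n.-tuple R) :
  simplex (tcons (t, x)) <-> simplex x /\ 0 <= t <= 1 - norm1 x.
Proof.
rewrite /simplex/= norm1_tcons; split => [[h1 h2]|[[h1 h2] /andP[t0 t1]]].
  have h3 i : 0 <= tnth x i by have := h1 (lift ord0 i); rewrite tnthS.
  have t0 : 0 <= t by exact: (h1 ord0).
  have : 0 <= norm1 x by apply: sumr_ge0.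
  by move=> ?; split; [split=> //; lra|lra].
split; last by lra.
by move=> i; case: (unliftP ord0 i) => [j|] ->; rewrite ?tnthS.
Qed.

Lemma measurable_norm1 n : measurable_fun [set: n.-tuple R] (@norm1 R n).
Proof. by apply: measurable_sum => i; exact: measurable_tnth. Qed.

Lemma measurable_simplex n : measurable (@simplex R n).
Proof.
rewrite (_ : @simplex R n = (\bigcap_(i in [set: 'I_n])
    ([set: n.-tuple R] `&` [set x | cst 0 x <= tnth x i])) `&`
    ([set: n.-tuple R] `&` [set x | norm1 x <= cst 1 x])).
  apply: measurableI.
    apply: fin_bigcap_measurable => // i _.
    by apply: measurable_fun_le => //; exact: measurable_tnth.
  by apply: measurable_fun_le => //; exact: measurable_norm1.
apply/seteqP; split => x /=.
  by move=> [h1 h2]; split => // i _; split => //; exact: h1.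
by move=> [h1 [_ h2]]; split => // i; have [] := h1 i I.
Qed.

(** The exponent [b] of the last barycentric coordinate is a separate argument because the induction
    on the dimension changes it. *)
Definition dirichlet_fun n (m : 'I_n -> nat) (b : nat) (x : n.-tuple R) : R :=
  (\prod_(i < n) tnth x i ^+ m i) * (1 - norm1 x) ^+ b.

Lemma measurable_dirichlet_fun n (m : 'I_n -> nat) b :
  measurable_fun [set: n.-tuple R] (dirichlet_fun m b).
Proof.
apply: measurable_funM.
  by apply: measurable_prod => i _; apply: measurable_funX;
    exact: measurable_tnth.
apply: measurable_funX; apply: measurable_funB => //.
exact: measurable_norm1.
Qed.

Lemma dirichlet_fun_ge0 n (m : 'I_n -> nat) b x :
  simplex x -> 0 <= dirichlet_fun m b x.
Proof.
move=> [x0 x1]; rewrite mulr_ge0 ?exprn_ge0 ?subr_ge0//.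
by rewrite prodr_ge0// => i _; rewrite exprn_ge0.
Qed.

(** Integrating out the first coordinate is a Beta integral over a segment of length [1 - norm1 x].
    It raises the exponent of the last barycentric coordinate to [m ord0 + b + 1], and the factorial
    of that number cancels against the induction hypothesis. *)
Lemma dirichlet_integral n (m : 'I_n -> nat) b :
  (\int[@lebesgue_tuple R n]_(x in @simplex R n) (dirichlet_fun m b x)%:E =
   ((\prod_(i < n) (m i)`! * b`!)%:R / (n + \sum_(i < n) m i + b)`!%:R)%:E)%E.
Proof.
elim: n m b => [|n IHn] m b.
  rewrite integral_dirac//; last 2 first.
  - exact: measurable_simplex.
  - apply/measurable_EFinP; apply: measurable_funTS.
    exact: measurable_dirichlet_fun.
  rewrite diracE mem_set/=; last first.
    by split; [case|rewrite /norm1 big_ord0].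
  rewrite mul1e /dirichlet_fun /norm1 !big_ord0 subr0 expr1n !mul1n !mul1r.
  by rewrite add0n mulfV// pnatr_eq0 -lt0n fact_gt0.
rewrite integral_mkcond integral_lebesgue_tupleS; last 2 first.
- apply/(measurable_restrictT _ _).1; first exact: measurable_simplex.
  apply/measurable_EFinP; apply: measurable_funTS.
  exact: measurable_dirichlet_fun.
- by apply: erestrict_ge0 => x Sx; rewrite lee_fin dirichlet_fun_ge0.
pose m' (i : 'I_n) := m (lift ord0 i).
pose c : R := ((m ord0)`! * b`!)%:R / (m ord0 + b).+1`!%:R.
transitivity (\int[@lebesgue_tuple R n]_(x in @simplex R n)
    (c%:E * (dirichlet_fun m' (m ord0 + b).+1 x)%:E))%E.
  rewrite [RHS]integral_mkcond; apply: eq_integral => x _.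
  (* Outside the lower simplex the fibre is empty, so the inner integral is 0. *)
  rewrite patchE; case: ifPn => [/set_mem Sx|Sx]; last first.
    apply: integral0_eq => t _; rewrite patchE ifN//.
    by apply: contra Sx => /set_mem/simplex_tcons[? _]; exact/mem_set.
  transitivity (\int[lebesgue_measure]_(t in `[0%R, (1 - norm1 x)%R])
      ((\prod_(i < n) tnth x i ^+ m' i)%:E *
       (t ^+ m ord0 * ((1 - norm1 x) - t) ^+ b)%:E))%E.
    rewrite [RHS]integral_mkcond; apply: eq_integral => t _.
    rewrite !patchE.
    have -> : (tcons (t, x) \in @simplex R n.+1) =
        (t \in `[0%R, 1 - norm1 x]%classic).
      apply/idP/idP => /set_mem; rewrite ?simplex_tcons.
        by move=> [_ ?]; apply/mem_set; rewrite /= in_itv.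
      by rewrite /= in_itv/= => ?; apply/mem_set/simplex_tcons.
    case: ifP => // _; rewrite -EFinM /dirichlet_fun norm1_tcons big_ord_recl.
    congr (_%:E); rewrite opprD addrA addrAC mulrCA mulrA; congr (_ * _ * _).
    by apply: eq_bigr => i _; rewrite tnthS.
  have x1 : 0 <= 1 - norm1 x by case: Sx; rewrite subr_ge0.
  rewrite ge0_integralZl//; last 3 first.
  - apply/measurable_EFinP/measurable_funM; apply: measurable_funX => //.
    exact: measurable_funB.
  - move=> t; rewrite /= in_itv/= => /andP[t0 t1].
    by rewrite lee_fin mulr_ge0 ?exprn_ge0 ?subr_ge0.
  - by rewrite lee_fin prodr_ge0// => i _; rewrite exprn_ge0//; case: Sx.
  rewrite integral_beta// -!EFinM; congr (_%:E).
  by rewrite mulrCA.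
have c0 : 0 <= c by rewrite divr_ge0.
rewrite ge0_integralZl//; last 3 first.
- exact: measurable_simplex.
- apply/measurable_EFinP; apply: measurable_funTS.
  exact: measurable_dirichlet_fun.
- by move=> x Sx; rewrite lee_fin dirichlet_fun_ge0.
rewrite IHn -EFinM; congr (_%:E).
rewrite /c mulrACA -invfM -!natrM !big_ord_recl.
have -> : (n + \sum_(i < n) m' i + (m ord0 + b).+1 =
  n.+1 + (m ord0 + \sum_(i < n) m' i) + b)%N by lia.
set F := _`!; set D := _`!; set P := (\prod_(i < n) _)%N.
rewrite mulnACA mulnA.
set K := ((m ord0 + b).+1)`!; set G := (n.+1 + _ + b)`!.
transitivity ((F * P * D)%:R * K%:R / (K%:R * G%:R) : R).
  by congr (_ / _); exact: natrM.
by rewrite [K%:R * _]mulrC -mulf_div divff ?mulr1// pnatr_eq0 -lt0n fact_gt0.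
Qed.

Lemma simplex_monomial_integral d (m : 'I_d.+1 -> nat) :
  (\int[@lebesgue_tuple R d]_(x in @simplex R d)
     (\prod_(i < d.+1) tnth (bary x) i ^+ m i)%:E =
   ((\prod_(i < d.+1) (m i)`!)%:R / (d + \sum_(i < d.+1) m i)`!%:R)%:E)%E.
Proof.
have := dirichlet_integral
  (fun i : 'I_d => m (widen_ord (leqnSn d) i)) (m ord_max).
rewrite !big_ord_recr addnA => <-; apply: eq_integral => x _.
rewrite big_ord_recr /dirichlet_fun; congr (_ * _)%:E.
  apply: eq_bigr => i _; congr (_ ^+ _).
  by rewrite !(tnth_nth 0) /= nth_rcons size_tuple ltn_ord.
by congr (_ ^+ _); rewrite (tnth_nth 0) /= nth_rcons size_tuple ltnn eqxx.
Qed.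

Lemma simplex_poly_integral d (f : mpolynomial d.+1 R) :
  (\int[@lebesgue_tuple R d]_(x in @simplex R d) (mpeval f (bary x))%:E =
   (\sum_(m <- mpoly.msupp f) mpoly.mcoeff m f *
      ((\prod_(i < d.+1) (m i)`!)%:R / (d + mpoly.mdeg m)`!%:R))%:E)%E.
Proof.
pose h (m : mpoly.multinom d.+1) (x : d.-tuple R) :=
  \prod_(i < d.+1) tnth (bary x) i ^+ m i.
(* Monomials in the barycentric coordinates are nonnegative on the simplex, so integrability amounts
   to the finiteness of the integral already computed. *)
have inth m : (@lebesgue_tuple R d).-integrable (@simplex R d) (EFin \o h m).
  apply/integrableP; split.
    apply/measurable_EFinP; apply: measurable_funTS.
    apply: measurable_prod => i _; apply: measurable_funX.
    have mb := @measurable_norm1 d.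
    case: (unliftP ord_max i) => [j|] ->.
      rewrite (_ : (fun x => _) = (@tnth d R ^~ j)); last first.
        apply/funext => x; rewrite !(tnth_nth 0) lift_max /= nth_rcons.
        by rewrite size_tuple ltn_ord.
      exact: measurable_tnth.
    rewrite (_ : (fun x => _) = (fun x => 1 - @norm1 R d x)); last first.
      apply/funext => x; rewrite (tnth_nth 0) /= nth_rcons size_tuple.
      by rewrite ltnn eqxx.
    exact: measurable_funB.
  rewrite (eq_integral (EFin \o h m)); last first.
    move=> x /set_mem [x0 x1] /=; rewrite ger0_norm//.
    apply: prodr_ge0 => i _; apply: exprn_ge0.
    rewrite (tnth_nth 0) /= nth_rcons size_tuple.
    case: ltngtP => [id|//|_]; last by rewrite subr_ge0.
    by have := x0 (Ordinal id); rewrite (tnth_nth 0).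
  by rewrite simplex_monomial_integral ltry.
transitivity (\int[@lebesgue_tuple R d]_(x in @simplex R d)
  \sum_(m <- mpoly.msupp f) ((mpoly.mcoeff m f)%:E * (h m x)%:E))%E.
  apply: eq_integral => x _; rewrite mpoly.mevalE sumEFin.
  by congr (_%:E); apply: eq_bigr => m _; rewrite EFinM.
rewrite integral_sum; last 2 first.
- exact: measurable_simplex.
- by move=> m; exact: (integrableZl (@measurable_simplex d) _ (inth m)).
rewrite -sumEFin; apply: eq_bigr => m _.
rewrite (integralZl (@measurable_simplex d) (inth m)).
by rewrite simplex_monomial_integral -EFinM mpoly.mdegE.
Qed.

End DirichletIntegral.

(** * Permutation means of monomials in terms of power sums *)

Section PermutationMeans.
Context {R : realType}.

Definition permpt n (y : n.-tuple R) (s : 'S_n) : n.-tuple R :=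
  [tuple tnth y (s i) | i < n].

Definition perm_mean n (F : 'S_n -> R) : R := (\sum_s F s) / n`!%:R.

(** Multiplication by [s0] carries the stabilizer of [y] onto the fibre through [s0]. *)
Lemma card_permpt_fiber n (y : n.-tuple R) (s0 : 'S_n) :
  #|[pred s | permpt y s == permpt y s0]| = #|[pred s | permpt y s == y]|.
Proof.
rewrite -!sum1_card [LHS](reindex_inj (mulgI s0)) /=.
apply: eq_bigl => s; rewrite !inE; apply/eqP/eqP => /(congr1 (@tnth n R)) h.
  apply/eq_from_tnth => i; have := congr1 (fun g => g ((s0^-1)%g i)) h.
  by rewrite /= !tnth_mktuple permM permKV.
apply/eq_from_tnth => i; have := congr1 (fun g => g (s0 i)) h.
by rewrite /= !tnth_mktuple permM.
Qed.

(** Orbit-stabilizer: every point of the orbit is reached by equally many permutations. *)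
Lemma sum_perm_orbit n (y : n.-tuple R) (F : n.-tuple R -> R) :
  \sum_(s : 'S_n) F (permpt y s) =
  #|[pred s | permpt y s == y]|%:R * \sum_(z <- perm_orbit y) F z.
Proof.
pose l := [seq permpt y s | s : 'S_n].
have -> : \sum_(s : 'S_n) F (permpt y s) = \sum_(z <- l) F z.
  by rewrite big_map big_enum.
rewrite -big_undup_iterop_count mulr_sumr.
apply: eq_big_seq => z; rewrite mem_undup => /mapP[s0 _ ->].
rewrite -(card_permpt_fiber y s0) mulr_natl.
rewrite count_map -size_filter.
rewrite (_ : size _ = #|[pred s | permpt y s == permpt y s0]|); last first.
  rewrite cardE /enum_mem -filter_predI; congr size.
  by apply: eq_filter => s; rewrite !inE /= ?inE andbT.
by rewrite /=.
Qed.

(** Applied to the constant 1, the orbit-stabilizer identity factors [n!] as stabilizer times orbit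
    size, and the order of the stabilizer cancels. *)
Lemma orbit_meanE n (f : mpolynomial n R) (y : n.-tuple R) :
  orbit_mean f y = perm_mean (fun s => mpeval f (permpt y s)).
Proof.
have h1 := sum_perm_orbit y (fun z => mpeval f z).
have := sum_perm_orbit y (fun=> 1); rewrite /perm_mean /orbit_mean h1.
rewrite sumr_const big_const_seq count_predT -Monoid.iteropE /= => h2.
have {}h2 : n`!%:R = #|[pred s | permpt y s == y]|%:R *
                     (size (perm_orbit y))%:R :> R.
  by rewrite -h2 -card_Sn; congr _%:R;
    apply: eq_card => s; rewrite !inE.
have K0 : #|[pred s | permpt y s == y]|%:R != 0 :> R.
  rewrite pnatr_eq0 -lt0n; apply/card_gt0P; exists 1%g.
  rewrite inE; apply/eqP/eq_from_tnth => i.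
  by rewrite tnth_mktuple perm1.
by rewrite h2 -mulf_div divff// mul1r.
Qed.

(** Only positions that carry an exponent are listed, so that the mean over [s] depends on the list
    [mu] alone. *)
Definition sympow n (y : n.-tuple R) (is_ : seq 'I_n) (mu : seq nat)
    (s : 'S_n) : R := \prod_(q <- zip is_ mu) tnth y (s q.1) ^+ q.2.

(** These are the exponent lists that arise when a new factor of exponent [b] falls on a position
    already in use. *)
Fixpoint bumps (b : nat) (mu : seq nat) : seq (seq nat) :=
  if mu is c :: r then ((b + c)%N :: r) :: [seq c :: t | t <- bumps b r]
  else [::].

Lemma size_bumps b mu t : t \in bumps b mu -> size t = size mu.
Proof.
elim: mu t => [//|c r IHr] t; rewrite inE => /predU1P[->//|/mapP[u ur ->]] /=.
by rewrite IHr.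
Qed.

Lemma sum_sympow_bumps n (y : n.-tuple R) is_ b mu (s : 'S_n) :
  size is_ = size mu ->
  \sum_(l <- is_) tnth y (s l) ^+ b * sympow y is_ mu s =
  \sum_(t <- bumps b mu) sympow y is_ t s.
Proof.
elim: is_ mu => [|i is_ IH] [|c mu]//=; first by rewrite !big_nil.
move=> /succn_inj sz.
rewrite !big_cons /= big_map /sympow /= !big_cons exprD mulrA; congr (_ + _).
have := IH mu sz; rewrite /sympow => {}IH.
under [RHS]eq_bigr do rewrite big_cons /=.
rewrite -mulr_sumr -IH mulr_sumr; apply: eq_bigr => l _.
by rewrite mulrCA.
Qed.

Definition psum n (y : n.-tuple R) (b : nat) : R := \sum_(i < n) tnth y i ^+ b.

(* The mean of the monomial x^mu in terms of the power sums p of its n values;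
   k must be size mu. *)
Fixpoint pmean (n : nat) (p : nat -> R) (k : nat) (mu : seq nat) : R :=
  if k is k'.+1 then
    (p (head 0%N mu) * pmean n p k' (behead mu) -
     \sum_(t <- bumps (head 0%N mu) (behead mu)) pmean n p k' t) / (n - k')%:R
  else 1.

(** Multiplying the mean of [mu] by [psum y b] places a factor of exponent [b] at each of the [n]
    positions in turn. Positions in [is_] give the terms of [bumps], the other [n - size mu] all
    give the wanted mean, and solving for it is the recursion of [pmean]. *)
Lemma perm_mean_sympow n (y : n.-tuple R) is_ mu :
  uniq is_ -> size is_ = size mu ->
  perm_mean (sympow y is_ mu) = pmean n (psum y) (size mu) mu.
Proof.
have n0 : n`!%:R != 0 :> R by rewrite pnatr_eq0 -lt0n fact_gt0.
have [k] := ubnP (size mu).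
elim: k is_ mu => // k IHk [|i is_] [|b mu]//=.
  move=> _ _ _; rewrite /perm_mean (eq_bigr (fun=> 1)); last first.
    by move=> s _; rewrite /sympow big_nil.
  by rewrite sumr_const card_Sn divff.
rewrite ltnS => muk /andP[iis uis] /succn_inj sz.
pose G l := perm_mean (sympow y (l :: is_) (b :: mu)).
(* Reindexing by the transposition of [i] and [l] exchanges the two new positions and fixes those in
   [is_]. *)
have GE l : l \notin is_ -> G l = G i.
  move=> lis; rewrite /G /perm_mean; congr (_ / _).
  rewrite (reindex_inj (mulgI (tperm i l))) /=; apply: eq_bigr => s _.
  rewrite /sympow /= !big_cons /= permM tpermR; congr (_ * _).
  apply: eq_big_seq => q /(map_f fst).
  rewrite -/unzip1 unzip1_zip ?sz// => qis.
  rewrite permM tpermD//; first by apply: contraNneq iis => ->.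
  by apply: contraNneq lis => ->.
have sumG : \sum_l G l = psum y b * perm_mean (sympow y is_ mu).
  rewrite /G /perm_mean -mulr_suml mulrA exchange_big mulr_sumr; congr (_ / _).
  apply: eq_bigr => s _; rewrite /psum [in RHS](reindex_inj (@perm_inj _ s)).
  by rewrite mulr_suml; apply: eq_bigr => l _; rewrite /sympow /= big_cons.
have sumGis : \sum_(l <- is_) G l =
    \sum_(t <- bumps b mu) perm_mean (sympow y is_ t).
  rewrite /G /perm_mean -!mulr_suml; congr (_ / _).
  rewrite exchange_big [RHS]exchange_big; apply: eq_bigr => s _.
  rewrite -sum_sympow_bumps//.
  by apply: eq_bigr => l _; rewrite /sympow /= big_cons.
have szn : (size mu < n)%N.
  have u : uniq (i :: is_) by rewrite /= iis.
  have := max_card (mem (i :: is_)).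
  by rewrite (card_uniqP u) card_ord /= sz.
have sumGC : \sum_(l | l \notin is_) G l = (n - size mu)%:R * G i.
  rewrite (eq_bigr (fun=> G i)) => [|l]; last exact: GE.
  rewrite sumr_const mulr_natl; congr (_ *+ _).
  have := cardC (mem is_); rewrite card_ord (card_uniqP uis) sz.
  by move=> /(congr1 (subn^~ (size mu))); rewrite addKn.
have nk0 : (n - size mu)%:R != 0 :> R by rewrite pnatr_eq0 subn_eq0 -ltnNge.
apply: (mulfI nk0); rewrite [RHS]mulrCA divff// mulr1.
rewrite -[LHS]sumGC -(IHk is_)//.
rewrite [in RHS](eq_big_seq (fun t => perm_mean (sympow y is_ t))).
  rewrite -sumG -sumGis.
  by rewrite [X in _ = X - _](bigID (mem is_)) big_uniq//= addrAC subrr add0r.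
by move=> t tb; rewrite -(size_bumps tb) -(IHk is_) ?(size_bumps tb).
Qed.

(* When p 1 = 1, the mean of every monomial of degree 5 is of this form. *)
Definition affine_psum (c0 c2 c3 c4 c5 c22 c23 : R) (p : nat -> R) : R :=
  c0 + c2 * p 2 + c3 * p 3 + c4 * p 4 + c5 * p 5 + c22 * p 2 ^+ 2 +
  c23 * (p 2 * p 3).

(** * Closed forms for the seven partitions of 5 *)

Section Formulas.
Variables (n : nat) (p : nat -> R).

Let nz k : (k < n)%N -> (n - k)%:R != 0 :> R.
Proof. by move=> kn; rewrite pnatr_eq0 subn_eq0 -ltnNge. Qed.

(** The casts [(n - k)%:R] are generalized to atoms with their nonvanishing, so [field] does not
    meet truncated subtraction. *)
Ltac pmean_field p1 kn :=
  rewrite /affine_psum /=; do ?[rewrite !(big_cons, big_nil) /=]; rewrite ?p1;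
  have := nz kn; do ?[move/ltnW: kn => kn; have := nz kn]; rewrite ?subn0;
  do ?[move: (n - _)%:R => ?]; move: (n%:R) => ?; intros;
  field; rewrite ?andbT; do ?[apply/andP; split].

(** In each closed form, for power sums [p], the numerator is the monomial summed over distinct
    indices, expanded by inclusion-exclusion on coincidences; the denominator counts the tuples of
    distinct indices. *)
Lemma pmean5 : p 1 = 1 -> (0 < n)%N ->
  pmean n p 1 [:: 5]%N =
  affine_psum 0 0 0 0 1 0 0 p / n%:R.
Proof. by move=> p1 kn; pmean_field p1 kn. Qed.

Lemma pmean41 : p 1 = 1 -> (1 < n)%N ->
  pmean n p 2 [:: 4; 1]%N =
  affine_psum 0 0 0 1 (-1) 0 0 p / (n%:R * (n - 1)%:R).
Proof. by move=> p1 kn; pmean_field p1 kn. Qed.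

Lemma pmean32 : p 1 = 1 -> (1 < n)%N ->
  pmean n p 2 [:: 3; 2]%N =
  affine_psum 0 0 0 0 (-1) 0 1 p / (n%:R * (n - 1)%:R).
Proof. by move=> p1 kn; pmean_field p1 kn. Qed.

Lemma pmean311 : p 1 = 1 -> (2 < n)%N ->
  pmean n p 3 [:: 3; 1; 1]%N =
  affine_psum 0 0 1 (-2) 2 0 (-1) p / (n%:R * (n - 1)%:R * (n - 2)%:R).
Proof. by move=> p1 kn; pmean_field p1 kn. Qed.

Lemma pmean221 : p 1 = 1 -> (2 < n)%N ->
  pmean n p 3 [:: 2; 2; 1]%N =
  affine_psum 0 0 0 (-1) 2 1 (-2) p / (n%:R * (n - 1)%:R * (n - 2)%:R).
Proof. by move=> p1 kn; pmean_field p1 kn. Qed.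

Lemma pmean2111 : p 1 = 1 -> (3 < n)%N ->
  pmean n p 4 [:: 2; 1; 1; 1]%N =
  affine_psum 0 1 (-3) 6 (-6) (-3) 5 p /
  (n%:R * (n - 1)%:R * (n - 2)%:R * (n - 3)%:R).
Proof. by move=> p1 kn; pmean_field p1 kn. Qed.

(** The coefficients are the signed sizes of the conjugacy classes of the symmetric group on 5
    letters. *)
Lemma pmean11111 : p 1 = 1 -> (4 < n)%N ->
  pmean n p 5 [:: 1; 1; 1; 1; 1]%N =
  affine_psum 1 (-10) 20 (-30) 24 15 (-20) p /
  (n%:R * (n - 1)%:R * (n - 2)%:R * (n - 3)%:R * (n - 4)%:R).
Proof. by move=> p1 kn; pmean_field p1 kn. Qed.

End Formulas.

(** * The moment equations and their consequences for quintic monomials *)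

Section Moments.
Variables (n : nat) (ly : seq (R * n.-tuple R)).
Let N : R := n%:R.

(* The right-hand sides are the means under the uniform law on the simplex. *)
Definition simplex_moments : Prop :=
  [/\ forall q, q \in ly -> psum q.2 1 = 1,
      \sum_(q <- ly) q.1 = 1,
      [/\ \sum_(q <- ly) q.1 * psum q.2 2 = 2 / (N + 1),
          \sum_(q <- ly) q.1 * psum q.2 3 = 6 / ((N + 1) * (N + 2)),
          \sum_(q <- ly) q.1 * psum q.2 4 = 24 / ((N + 1) * (N + 2) * (N + 3))
        & \sum_(q <- ly) q.1 * psum q.2 5 =
          120 / ((N + 1) * (N + 2) * (N + 3) * (N + 4))],
      \sum_(q <- ly) q.1 * psum q.2 2 ^+ 2 =
      4 * (N + 5) / ((N + 1) * (N + 2) * (N + 3))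
    & \sum_(q <- ly) q.1 * (psum q.2 2 * psum q.2 3) =
      12 * (N + 9) / ((N + 1) * (N + 2) * (N + 3) * (N + 4))].

Hypothesis lyM : simplex_moments.

Lemma sum_affine_psum c0 c2 c3 c4 c5 c22 c23 D :
  \sum_(q <- ly) q.1 * (affine_psum c0 c2 c3 c4 c5 c22 c23 (psum q.2) / D) =
  (c0 + c2 * (2 / (N + 1)) + c3 * (6 / ((N + 1) * (N + 2))) +
   c4 * (24 / ((N + 1) * (N + 2) * (N + 3))) +
   c5 * (120 / ((N + 1) * (N + 2) * (N + 3) * (N + 4))) +
   c22 * (4 * (N + 5) / ((N + 1) * (N + 2) * (N + 3))) +
   c23 * (12 * (N + 9) / ((N + 1) * (N + 2) * (N + 3) * (N + 4)))) / D.
Proof.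
have [_ h0 [<- <- <- <-] <- <-] := lyM.
(* The constant term is multiplied by the total weight 1 to become a weighted sum like the
   others. *)
rewrite -[X in X + c2 * _]mulr1 -h0 !mulr_sumr -!big_split mulr_suml.
apply: eq_bigr => q _ /=; rewrite /affine_psum mulrA; congr (_ / _).
by ring.
Qed.

Ltac sum_pmean_field pmeanE p1 kn NE nz :=
  rewrite (eq_big_seq _ (fun q (qly : q \in ly) =>
    congr1 ( *%R q.1) (pmeanE _ _ (p1 q qly) kn)));
  rewrite sum_affine_psum -/N ?NE; [ | lia ..];
  have := nz _ kn; do ?[move/ltnW: kn => kn; have := nz _ kn];
  rewrite ?subr0; intros;
  rewrite !(big_cons, big_nil) !factS ?fact0;
  field; do ?[apply/andP; split] => //.

(** For [n = d + 1] the right-hand side is [d!] times the Dirichlet integral of the monomial, since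
    [(d + 5)! / d!] is the product of [n, ..., n + 4]. *)
Lemma sum_pmean mu : mu \in
  [:: [:: 5]; [:: 4; 1]; [:: 3; 2]; [:: 3; 1; 1]; [:: 2; 2; 1]; [:: 2; 1; 1; 1];
      [:: 1; 1; 1; 1; 1]]%N -> (size mu <= n)%N ->
  \sum_(q <- ly) q.1 * pmean n (psum q.2) (size mu) mu =
  (\prod_(c <- mu) c`!)%:R / (N * (N + 1) * (N + 2) * (N + 3) * (N + 4)).
Proof.
have [p1 _ _ _ _] := lyM.
have NE k : (k <= n)%N -> (n - k)%:R = N - k%:R by move=> kn; rewrite natrB.
have nz k : (k < n)%N -> N - k%:R != 0.
  by move=> kn; rewrite subr_eq0 eqr_nat; lia.
have N0 : 0 <= N by rewrite /N.
have N1 : N + 1 != 0 by rewrite gt_eqF//; lra.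
have N2 : N + 2 != 0 by rewrite gt_eqF//; lra.
have N3 : N + 3 != 0 by rewrite gt_eqF//; lra.
have N4 : N + 4 != 0 by rewrite gt_eqF//; lra.
rewrite !inE.
move=> /predU1P[->|/predU1P[->|/predU1P[->|/predU1P[->|/predU1P[->|
  /predU1P[->|/eqP->]]]]]] kn; rewrite /= in kn.
- sum_pmean_field @pmean5 p1 kn NE nz.
- sum_pmean_field @pmean41 p1 kn NE nz.
- sum_pmean_field @pmean32 p1 kn NE nz.
- sum_pmean_field @pmean311 p1 kn NE nz.
- sum_pmean_field @pmean221 p1 kn NE nz.
- sum_pmean_field @pmean2111 p1 kn NE nz.
- sum_pmean_field @pmean11111 p1 kn NE nz.
Qed.

End Moments.

(** Six positive parts would already exceed 5, so finitely many shapes remain. *)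
Lemma sorted_partition5 (mu : seq nat) :
  sorted geq mu -> 0%N \notin mu -> sumn mu = 5 ->
  mu \in [:: [:: 5]; [:: 4; 1]; [:: 3; 2]; [:: 3; 1; 1]; [:: 2; 2; 1];
             [:: 2; 1; 1; 1]; [:: 1; 1; 1; 1; 1]]%N.
Proof.
case: mu => [|a [|b [|c [|d [|e [|f mu]]]]]] //=;
  rewrite !inE ?eqseq_cons ?eqxx ?andbT ?andbF ?orbF /=; lia.
Qed.

(** Turns a multinomial exponent into a partition. The operation is arbitrary because the lemma
    serves the sum of the exponents, the product of their factorials and the product of powers,
    where a zero exponent contributes the neutral element each time. *)
Lemma sorted_support n (m : 'I_n -> nat) : exists is_ : seq 'I_n,
  [/\ uniq is_, sorted geq (map m is_), 0%N \notin map m is_ &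
   forall (T : Type) (idx : T) (op : Monoid.com_law idx) (F : 'I_n -> T),
     (forall i, m i = 0%N -> F i = idx) ->
     \big[op/idx]_(i <- is_) F i = \big[op/idx]_i F i].
Proof.
pose l := [seq i <- enum 'I_n | m i != 0%N].
exists (sort (fun i j => m j <= m i)%N l); split.
- by rewrite sort_uniq filter_uniq// enum_uniq.
- rewrite sorted_map; apply: sort_sorted => i j; exact: leq_total.
- apply/mapP => -[i]; rewrite mem_sort mem_filter => /andP[mi _] /esym/eqP.
  exact/negP.
- move=> T idx op F F0; rewrite (perm_big _ (permEl (perm_sort _ _))).
  rewrite big_filter big_mkcond big_enum; apply: eq_bigr => i _.
  by case: eqP => //= /F0.
Qed.

Lemma sum_orbit_mean n (ly : seq (R * n.-tuple R)) (f : mpolynomial n R) :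
  simplex_moments ly -> homogeneous f 5 ->
  \sum_(q <- ly) q.1 * orbit_mean f q.2 =
  \sum_(m <- mpoly.msupp f) mpoly.mcoeff m f *
    ((\prod_(i < n) (m i)`!)%:R /
     (n%:R * (n%:R + 1) * (n%:R + 2) * (n%:R + 3) * (n%:R + 4))).
Proof.
move=> lyM /mpoly.dhomogP hf.
transitivity (\sum_(q <- ly) \sum_(m <- mpoly.msupp f) mpoly.mcoeff m f *
   (q.1 * perm_mean (fun s => \prod_(i < n) tnth q.2 (s i) ^+ m i))).
  apply: eq_bigr => q _; rewrite orbit_meanE /perm_mean.
  under eq_bigr do rewrite mpoly.mevalE.
  rewrite exchange_big mulr_suml mulr_sumr; apply: eq_bigr => m _.
  rewrite -mulr_sumr mulrCA -mulrA [in LHS](mulrCA _ q.1).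
  congr (_ * (_ * (_ / _))); apply: eq_bigr => s _.
  by apply: eq_bigr => i _; rewrite tnth_mktuple.
rewrite exchange_big; apply: eq_big_seq => m mf.
rewrite -mulr_sumr; congr (_ * _).
have [is_ [uis smu mu0 bigE]] := sorted_support m.
have mu5 : sumn (map m is_) = 5.
  rewrite sumnE big_map bigE//.
  by rewrite -mpoly.mdegE; exact: hf _ mf.
have := sum_pmean lyM (sorted_partition5 smu mu0 mu5).
have szn : (size (map m is_) <= n)%N.
  have := max_card (mem is_).
  by rewrite (card_uniqP uis) card_ord size_map.
move=> /(_ szn); rewrite big_map bigE => [<-|i ->//].
apply: eq_bigr => q _; congr (_ * _).
rewrite -(perm_mean_sympow q.2 uis) ?size_map//.
rewrite /perm_mean; congr (_ / _); apply: eq_bigr => s _.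
rewrite -bigE => [|i ->]; last by rewrite expr0.
rewrite /sympow; elim: (is_) => [|i r IHr] /=; first by rewrite !big_nil.
by rewrite !big_cons IHr.
Qed.

End PermutationMeans.

(** * From quintic forms in barycentric coordinates to polynomials of degree at most 5 *)

Section SimplexRules.
Context {R : realType}.
Local Open Scope classical_set_scope.

Lemma simplex_integral_rule d (ly : seq (R * d.+1.-tuple R))
    (f : mpolynomial d.+1 R) :
  simplex_moments ly -> homogeneous f 5 ->
  (\int[@lebesgue_tuple R d]_(x in @simplex R d) (mpeval f (bary x))%:E =
   ((\sum_(q <- ly) q.1 * orbit_mean f q.2) / d`!%:R)%:E)%E.
Proof.
move=> lyM hf; rewrite simplex_poly_integral (sum_orbit_mean lyM hf) mulr_suml.
congr (_%:E); apply: eq_big_seq => m mf; rewrite -[RHS]mulrA; congr (_ * _).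
have -> : mpoly.mdeg m = 5%N by have /mpoly.dhomogP h := hf; exact: h.
rewrite -[RHS]mulrA -invfM; congr (_ / _).
have -> : (d + 5)`! = (d.+1 * d.+2 * d.+3 * d.+4 * d.+1.+4 * d`!)%N.
  by rewrite addnC !addSn add0n !factS; lia.
by rewrite !natrM; ring.
Qed.

Lemma perm_orbitP n (y z : n.-tuple R) :
  z \in perm_orbit y -> exists s : 'S_n, z = permpt y s.
Proof. by rewrite mem_undup => /mapP[s _ ->]; exists s. Qed.

Lemma psum_perm_orbit n (y z : n.-tuple R) b :
  z \in perm_orbit y -> psum z b = psum y b.
Proof.
move=> /perm_orbitP[s ->]; rewrite /psum [RHS](reindex_inj (@perm_inj _ s)).
by apply: eq_bigr => i _; rewrite tnth_mktuple.
Qed.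

Lemma unbaryE d (z : d.+1.-tuple R) i :
  tnth (unbary z) i = tnth z (widen_ord (leqnSn d) i).
Proof. by rewrite tnth_mktuple. Qed.

Lemma psum1_unbary d (z : d.+1.-tuple R) :
  psum z 1 = norm1 (unbary z) + tnth z ord_max.
Proof.
rewrite /psum /norm1 big_ord_recr /= expr1; congr (_ + _).
by apply: eq_bigr => i _; rewrite unbaryE expr1.
Qed.

Lemma bary_unbary d (z : d.+1.-tuple R) : psum z 1 = 1 -> bary (unbary z) = z.
Proof.
rewrite psum1_unbary => z1; apply/eq_from_tnth => i; rewrite (tnth_nth 0) /=.
rewrite nth_rcons size_map size_enum_ord.
case: ltngtP => [id||id].
- have -> : i = widen_ord (leqnSn d) (Ordinal id) by exact/val_inj.
  by rewrite -unbaryE (tnth_nth 0).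
- by have := ltn_ord i; rewrite ltnS leqNgt => /negP.
- have -> : i = ord_max by exact/val_inj.
  by rewrite -z1 addrAC subrr add0r.
Qed.

Lemma unbary_bary d (x : d.-tuple R) : unbary (bary x) = x.
Proof.
apply/eq_from_tnth => i; rewrite unbaryE (tnth_nth 0) /= nth_rcons size_tuple.
by rewrite ltn_ord -tnth_nth.
Qed.

Lemma psum_bary d (x : d.-tuple R) : psum (bary x) 1 = 1.
Proof.
rewrite psum1_unbary unbary_bary (tnth_nth 0) /= nth_rcons size_tuple.
by rewrite ltnn eqxx addrC subrK.
Qed.

Lemma simplex_unbary d (z : d.+1.-tuple R) :
  psum z 1 = 1 -> (forall i, 0 <= tnth z i) -> simplex (unbary z).
Proof.
move=> z1 z0; split; first by move=> i; rewrite unbaryE.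
by rewrite -z1 psum1_unbary lerDl.
Qed.

(** The degree is filled up with the sum of all [d + 1] variables, which equals 1 at barycentric
    points, so values there do not change. The subtraction is truncated, so [t] has to bound the
    degree for the result to be homogeneous. *)
Definition homogenize d t (g : mpolynomial d R) : mpolynomial d.+1 R :=
  \sum_(m <- mpoly.msupp g) mpoly.mcoeff m g *:
    ((\prod_(i < d) mpoly.mpolyX R (mpoly.mnm1 (widen_ord (leqnSn d) i)) ^+ m i) *
     (\sum_(i < d.+1) mpoly.mpolyX R (mpoly.mnm1 i)) ^+ (t - mpoly.mdeg m)).

Lemma homogenize_homog d t (g : mpolynomial d R) :
  degree_le g t -> homogeneous (homogenize t g) t.
Proof.
move=> gt; rewrite /homogenize big_seq; apply: rpred_sum => m mg.
apply: mpoly.dhomogZ.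
have mt : (mpoly.mdeg m <= t)%N.
  by have := mpoly.msize_mdeg_lt mg; lia.
rewrite -[X in mpoly.ishomog1 X](subnKC mt).
apply: mpoly.dhomogM.
  rewrite mpoly.mdegE; elim/big_ind2 : _ => [|p1 n1 p2 n2|i _].
  - exact: mpoly.dhomog1.
  - exact: mpoly.dhomogM.
  - rewrite -[X in mpoly.ishomog1 X]mul1n.
    apply: mpoly.dhomogMn; rewrite mpoly.dhomogX; apply/eqP.
    exact: mpoly.mdeg1.
rewrite -[X in mpoly.ishomog1 X]mul1n; apply: mpoly.dhomogMn.
apply: rpred_sum => i _; rewrite mpoly.dhomogX; apply/eqP.
exact: mpoly.mdeg1.
Qed.

Lemma meval_homogenize d t (g : mpolynomial d R) (z : d.+1.-tuple R) :
  psum z 1 = 1 -> mpeval (homogenize t g) z = mpeval g (unbary z).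
Proof.
move=> z1; rewrite /homogenize raddf_sum [RHS]mpoly.mevalE.
apply: eq_bigr => m _.
rewrite /= mpoly.mevalZ mpoly.mevalM rmorph_prod rmorphXn raddf_sum.
congr (_ * _).
rewrite [X in _ * X ^+ _](_ : _ = 1) ?expr1n ?mulr1.
  by apply: eq_bigr => i _; rewrite rmorphXn /= mpoly.mevalXU unbaryE.
rewrite -z1 /psum; apply: eq_bigr => i _.
by rewrite /= mpoly.mevalXU expr1.
Qed.

End SimplexRules.

(** * Nodes: distinctness, positivity and power sums *)

Section Nodes.
Context {R : realType}.

(** Within an orbit, [unbary] is injective because coordinates sum to 1. A node common to two orbits
    would give them the same second power sum, a permutation invariant assumed to separate them. *)
Lemma uniq_simplex_rule d (L : seq (rat * d.+1.-tuple R))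
    (w : rat -> d.+1.-tuple R -> R) :
  (forall q, q \in L -> psum q.2 1 = 1) ->
  uniq [seq psum q.2 2 | q <- L] ->
  uniq [seq q.2 | q <-
    flatten [seq [seq (w q.1 q.2, unbary z) | z <- perm_orbit q.2] | q <- L]].
Proof.
elim: L => [//|[l y] L IHL] L1 /= /andP[yL uL].
have y1 z : z \in perm_orbit y -> psum z 1 = 1.
  by move=> /psum_perm_orbit ->; exact: (L1 _ (mem_head _ _)).
rewrite map_cat cat_uniq IHL//; last first.
  by move=> q qL; apply: L1; rewrite inE qL orbT.
rewrite -map_comp andbT; apply/andP; split.
  rewrite map_inj_in_uniq ?undup_uniq// => z1 z2 z1y z2y /= e.
  by rewrite -(bary_unbary (y1 _ z1y)) e bary_unbary// y1.
apply/hasPn => x /mapP[_ /flattenP[_ /mapP[q qL ->] /mapP[z zq ->] ->]] /=.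
apply: contra yL => /mapP[z' z'y /= e].
apply/mapP; exists q => //.
have qz : psum z 1 = 1.
  by rewrite (psum_perm_orbit 1 zq) L1// inE qL orbT.
rewrite -(psum_perm_orbit 2 z'y) -(psum_perm_orbit 2 zq).
by rewrite -(bary_unbary (y1 _ z'y)) -e bary_unbary.
Qed.

Lemma positive_cubature_simplex_rule d (ly : seq (rat * d.+1.-tuple R)) :
  (forall q, q \in ly -> 0 <= q.1 /\ forall i, 0 <= tnth q.2 i) ->
  simplex_moments [seq (ratr q.1, q.2) | q <- ly] ->
  uniq [seq psum q.2 2 | q <- ly & q.1 != 0] ->
  positive_cubature (@simplex R d) (fun=> 1) 5 (simplex_rule ly).
Proof.
move=> ly0 lyM ly2; have [ly1 _ _ _ _] := lyM.
have {}ly1 q : q \in ly -> psum q.2 1 = 1.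
  by move=> qly; apply: (ly1 (ratr q.1, q.2)); apply/mapP; exists q.
split.
- pose w l (y : d.+1.-tuple R) : R := ratr l / (d`! * size (perm_orbit y))%:R.
  apply: (@uniq_simplex_rule _ [seq q <- ly | q.1 != 0] w) => // q.
  by rewrite mem_filter => /andP[_]; exact: ly1.
- move=> _ /flattenP[_ /mapP[q + ->] /mapP[z zq ->]] /=.
  rewrite mem_filter => /andP[q0 qly]; have [q1 q2] := ly0 _ qly; split.
    apply: simplex_unbary.
      by rewrite (psum_perm_orbit 1 zq) ly1.
    by move=> i; have [s ->] := perm_orbitP zq; rewrite tnth_mktuple.
  apply: divr_gt0; first by rewrite ltr0q lt_def q0.
  rewrite ltr0n muln_gt0 fact_gt0.
  by case: (perm_orbit _) zq.
- move=> g g5.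
  transitivity (\int[@lebesgue_tuple R d]_(x in @simplex R d)
      (mpeval (homogenize 5 g) (bary x))%:E)%E.
    apply: eq_integral => x _.
    by rewrite mulr1 meval_homogenize ?psum_bary// unbary_bary.
  rewrite (simplex_integral_rule lyM (homogenize_homog g5)); congr (_%:E).
  (* The rule drops the orbits of weight 0, and these contribute nothing to the weighted sum of
     means. *)
  rewrite big_flatten !big_map big_filter [RHS]big_mkcond mulr_suml.
  apply: eq_big_seq => q qly /=; case: eqP => [->|_] /=.
    by rewrite raddf0 !mul0r.
  rewrite big_map /orbit_mean mulrA mulr_sumr !mulr_suml.
  apply: eq_big_seq => z zq /=; rewrite meval_homogenize; last first.
    by rewrite (psum_perm_orbit 1 zq) ly1.
  by rewrite natrM invfM; ring.
Qed.

Lemma psum_scalept n (c : R) (y : n.-tuple R) b :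
  psum (scalept c y) b = c ^+ b * psum y b.
Proof.
rewrite /psum mulr_sumr; apply: eq_bigr => i _.
by rewrite tnth_mktuple exprMn.
Qed.

Lemma psum_vpt n k b : (k <= n)%N -> (0 < b)%N -> psum (vpt R n k) b = k%:R.
Proof.
move=> kn b0; rewrite /psum (eq_bigr (fun i : 'I_n => if (i < k)%N then 1 else 0)).
  rewrite -big_mkcond -(big_ord_widen n (fun=> 1)) //.
  by rewrite sumr_const card_ord.
by move=> i _; rewrite tnth_mktuple; case: ifP; rewrite ?expr1n// expr0n gtn_eqF.
Qed.

Lemma psum_upt n (a : R) p b : (p < n)%N -> (0 < b)%N ->
  psum (upt n a p) b = a ^+ b + p%:R.
Proof.
case: n => // n pn b0; rewrite /psum big_ord_recl tnth_mktuple /=; congr (_ + _).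
rewrite -(@psum_vpt n p b)// /psum; apply: eq_bigr => i _.
by rewrite !tnth_mktuple.
Qed.

Lemma eq_map_mul (S T : Type) (K : nzRingType) (s : seq S) (t : seq T)
    (f g : S -> K) (f' g' : T -> rat) (h : {rmorphism rat -> K}) :
  [seq f x | x <- s] = [seq h (f' y) | y <- t] ->
  [seq g x | x <- s] = [seq h (g' y) | y <- t] ->
  [seq f x * g x | x <- s] = [seq h (f' y * g' y) | y <- t].
Proof.
elim: s t => [|x s IHs] [|y t] //= [e1 e2] [e3 e4].
by rewrite rmorphM e1 e3 (IHs t).
Qed.

(** * Reduction of the rule to equations between rational numbers *)

Section Assemble.
Variables (d p m : nat) (a : rat).
Hypotheses (d2 : (2 <= d)%N) (pd : (p <= d)%N) (md : (0 < m <= d.+1)%N).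
Hypothesis a0 : 0 < a.

(** Taking values in [rat] makes the final conditions computable and independent of [R]. The
    formulas give the power sums for positive exponents only, since [psum y 0] also counts zero
    coordinates. *)
Definition node_psums : seq (nat -> rat) :=
  let v k b := k%:R^-1 ^+ b * k%:R in
  [:: v d.+1; v 1%N; v 2%N; v 3%N; v m;
      fun b => (a + p%:R)^-1 ^+ b * (a ^+ b + p%:R)].

Definition nodes : seq (d.+1.-tuple R) :=
  [:: scalept d.+1%:R^-1 (vpt R d.+1 d.+1); vpt R d.+1 1;
      scalept 2^-1 (vpt R d.+1 2); scalept 3^-1 (vpt R d.+1 3);
      scalept m%:R^-1 (vpt R d.+1 m);
      scalept (ratr a + p%:R)^-1 (upt d.+1 (ratr a) p)].

Lemma psum_nodes b : (0 < b)%N ->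
  [seq psum y b | y <- nodes] = [seq ratr (P b) | P <- node_psums].
Proof.
move=> b0; have [m0 m1] := andP md.
rewrite /= !psum_scalept !psum_vpt ?psum_upt; try lia.
rewrite !(ratr_nat, rmorphM, rmorphXn, fmorphV, rmorphD) /=.
(* The vertex is listed in [nodes] without scaling, hence the factor [1^-1] to remove. *)
by rewrite !ratr_nat invr1 expr1n mul1r.
Qed.

Lemma nodes_ge0 y i : y \in nodes -> 0 <= tnth y i.
Proof.
have v0 c k : 0 <= c -> 0 <= tnth (scalept c (vpt R d.+1 k)) i.
  by move=> c0; rewrite !tnth_mktuple mulr_ge0.
have ra0 : 0 < ratr a :> R by rewrite ltr0q.
rewrite !inE => /or4P[/eqP->|/eqP->|/eqP->|/or3P[/eqP->|/eqP->|/eqP->]];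
  try (by apply: v0; rewrite invr_ge0); rewrite !tnth_mktuple//.
apply: mulr_ge0; first by rewrite invr_ge0 addr_ge0// ltW.
by case: (_ == _) => //; exact: ltW.
Qed.

Definition weighted (l : seq rat) (F : (nat -> rat) -> rat) : rat :=
  \sum_(q <- zip l node_psums) q.1 * F q.2.

Lemma sum_weighted l (F : (nat -> rat) -> rat) (G : d.+1.-tuple R -> R) :
  [seq G y | y <- nodes] = [seq ratr (F P) | P <- node_psums] ->
  \sum_(q <- [seq (ratr q.1, q.2) | q <- zip l nodes]) q.1 * G q.2 =
  ratr (weighted l F).
Proof.
rewrite big_map /weighted; elim: nodes node_psums l => [|y ys IH] [|P Ps] [|l ls] //=;
  rewrite ?big_nil ?rmorph0// => -[e1 e2].
by rewrite !big_cons /= (IH _ _ e2) rmorphD rmorphM e1.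
Qed.

Definition weighted_moments (l : seq rat) : Prop :=
  let N : rat := d.+1%:R in
  [/\ weighted l (fun=> 1) = 1,
      [/\ weighted l (fun P => P 2) = 2 / (N + 1),
          weighted l (fun P => P 3) = 6 / ((N + 1) * (N + 2)),
          weighted l (fun P => P 4) = 24 / ((N + 1) * (N + 2) * (N + 3))
        & weighted l (fun P => P 5) =
          120 / ((N + 1) * (N + 2) * (N + 3) * (N + 4))],
      weighted l (fun P => P 2 ^+ 2) =
      4 * (N + 5) / ((N + 1) * (N + 2) * (N + 3))
    & weighted l (fun P => P 2 * P 3) =
      12 * (N + 9) / ((N + 1) * (N + 2) * (N + 3) * (N + 4))].

Lemma psum1_nodes y : y \in nodes -> psum y 1 = 1.
Proof.
have [m0 _] := andP md.
move=> /(map_f (fun y => psum y 1)); rewrite psum_nodes// => /mapP[P + ->].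
have v1 k : (0 < k)%N -> k%:R^-1 ^+ 1 * k%:R = 1 :> rat.
  by move=> k0; rewrite expr1 mulVf// pnatr_eq0 -lt0n.
have ap : a + p%:R != 0 by rewrite gt_eqF// ltr_wpDr.
rewrite !inE => /or4P[/eqP->|/eqP->|/eqP->|/or3P[/eqP->|/eqP->|/eqP->]].
all: try by rewrite v1 ?rmorph1.
by rewrite !expr1 mulVf ?rmorph1.
Qed.

Lemma simplex_moments_nodes l : weighted_moments l ->
  simplex_moments [seq (ratr q.1, q.2) | q <- zip l nodes].
Proof.
move=> [h0 [h2 h3 h4 h5] h22 h23].
have psumE b (b0 : (0 < b)%N) := sum_weighted l (psum_nodes b0).
have xE (x : rat) (k : nat) : ratr (x + k%:R) = ratr x + k%:R :> R.
  by rewrite rmorphD /= ratr_nat.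
have divE (k : nat) (x : rat) : ratr (k%:R / x) = k%:R / ratr x :> R.
  by rewrite fmorph_div /= ratr_nat.
have N1 : ratr (d.+1%:R + 1) = d.+1%:R + 1 :> R by rewrite (xE _ 1%N) ratr_nat.
have NE k : ratr (d.+1%:R + k%:R) = d.+1%:R + k%:R :> R by rewrite xE ratr_nat.
have mulE (x y : rat) : ratr (x * y) = ratr x * ratr y :> R by rewrite rmorphM.
have mulP b c : (0 < b)%N -> (0 < c)%N ->
    [seq psum y b * psum y c | y <- nodes] =
    [seq ratr (P b * P c) | P <- node_psums].
  by move=> b0 c0; apply: eq_map_mul; exact: psum_nodes.
split.
- move=> _ /mapP[q ql ->] /=; apply: psum1_nodes.
  have := map_f snd ql; rewrite -/unzip2.
  elim: l nodes {ql h0 h2 h3 h4 h5 h22 h23 psumE} => [|x l IH] [|y ys]//=.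
  by rewrite !inE => /predU1P[->|/IH ->]; rewrite ?eqxx ?orbT.
- have := @sum_weighted l (fun=> 1) (fun=> 1).
  rewrite h0 /= rmorph1 => /(_ erefl) h; rewrite -[RHS]h.
  by apply: eq_bigr => q _; rewrite mulr1.
- split.
  + by rewrite (psumE 2%N isT) h2 (divE 2%N) N1.
  + by rewrite (psumE 3%N isT) h3 (divE 6%N) mulE N1 (NE 2%N).
  + by rewrite (psumE 4%N isT) h4 (divE 24%N) !mulE N1 (NE 2%N) (NE 3%N).
  + by rewrite (psumE 5%N isT) h5 (divE 120%N) !mulE N1 (NE 2%N) (NE 3%N) (NE 4%N).
- rewrite (@sum_weighted l (fun P => P 2 ^+ 2) (fun y => psum y 2 ^+ 2)).
    rewrite h22 fmorph_div /= !mulE N1 (NE 2%N) (NE 3%N) (NE 5%N).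
    by rewrite (ratr_nat R 4).
  by rewrite mulP.
- rewrite (@sum_weighted l (fun P => P 2 * P 3) (fun y => psum y 2 * psum y 3)).
    rewrite h23 fmorph_div /= !mulE N1 (NE 2%N) (NE 3%N) (NE 4%N) (NE 9%N).
    by rewrite (ratr_nat R 12).
  by rewrite mulP.
Qed.

(** All remaining conditions are statements about explicit rationals: signs, moment equations, and
    distinct second power sums for the orbits in use. *)
Lemma valid_weights_nodes (l1 l2 l3 l4 l5 l6 : rat) :
  let l := [:: l1; l2; l3; l4; l5; l6] in
  [&& 0 <= l1, 0 <= l2, 0 <= l3, 0 <= l4, 0 <= l5 & 0 <= l6] ->
  weighted_moments l ->
  uniq [seq q.2 2 | q <- zip l node_psums & q.1 != 0] ->
  valid_weights d p m (ratr a : R) l1 l2 l3 l4 l5 l6.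
Proof.
move=> l l0 lM l2u; have lyM := simplex_moments_nodes lM.
split.
- exact: l0.
- by have [+ _ _ _] := lM; rewrite /weighted !big_cons big_nil !mulr1 addr0 !addrA.
- move=> f hf; rewrite (simplex_integral_rule lyM hf) -EFinM; congr (_%:E).
  rewrite mulrC divfK ?pnatr_eq0 -?lt0n ?fact_gt0//.
  by rewrite !big_cons big_nil addr0 !addrA.
- apply: (@positive_cubature_simplex_rule d (zip l nodes)) => //.
  + move=> q ql; split.
      have /allP : all (>= 0) l by rewrite /= andbT.
      by apply; exact: (map_f fst ql).
    by move=> i; exact: (nodes_ge0 _ (map_f snd ql)).
  (* Distinctness passes from rational to real values by injectivity of [ratr]. *)
  + rewrite -(map_inj_uniq (fmorph_inj (@ratr R))) in l2u.
    apply: etrans l2u; congr uniq; rewrite -map_comp.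
    have := @psum_nodes 2 isT; move: (l) (nodes) (node_psums).
    elim=> [|x s IHs] [|y t] [|P u]//= [e1 e2].
    by case: ifP => _ /=; rewrite ?e1 (IHs _ _ e2).
Qed.

End Assemble.

End Nodes.

(** * Numerical verification of the nine rules *)

Lemma weighted6 d p m a l1 l2 l3 l4 l5 l6 F :
  weighted d p m a [:: l1; l2; l3; l4; l5; l6] F =
  let v k b := k%:R^-1 ^+ b * k%:R in
  l1 * F (v d.+1) + l2 * F (v 1%N) + l3 * F (v 2%N) + l4 * F (v 3%N) +
  l5 * F (v m) + l6 * F (fun b => (a + p%:R)^-1 ^+ b * (a ^+ b + p%:R)).
Proof. by rewrite /weighted !big_cons big_nil addr0 !addrA. Qed.

Lemma weighted_momentsI d p m a l1 l2 l3 l4 l5 l6 :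
  (let v k b := k%:R^-1 ^+ b * k%:R in
  let w F : rat :=
    l1 * F (v d.+1) + l2 * F (v 1%N) + l3 * F (v 2%N) + l4 * F (v 3%N) +
    l5 * F (v m) + l6 * F (fun b => (a + p%:R)^-1 ^+ b * (a ^+ b + p%:R)) in
  let N : rat := d.+1%:R in
  [/\ w (fun=> 1) = 1,
      [/\ w (fun P => P 2) = 2 / (N + 1),
          w (fun P => P 3) = 6 / ((N + 1) * (N + 2)),
          w (fun P => P 4) = 24 / ((N + 1) * (N + 2) * (N + 3))
        & w (fun P => P 5) = 120 / ((N + 1) * (N + 2) * (N + 3) * (N + 4))],
      w (fun P => P 2 ^+ 2) = 4 * (N + 5) / ((N + 1) * (N + 2) * (N + 3))
    & w (fun P => P 2 * P 3) =
      12 * (N + 9) / ((N + 1) * (N + 2) * (N + 3) * (N + 4))]) ->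
  weighted_moments d p m a [:: l1; l2; l3; l4; l5; l6].
Proof. by rewrite /weighted_moments !weighted6. Qed.

Lemma uniq_node_psums d p m a (l : seq rat) :
  uniq [seq P 2 | P <- node_psums d p m a] -> size l = 6 ->
  uniq [seq q.2 2 | q <- zip l (node_psums d p m a) & q.1 != 0].
Proof.
move=> u sl; have := map_subseq (fun q : rat * (nat -> rat) => q.2 2)
  (filter_subseq (fun q => q.1 != 0) (zip l (node_psums d p m a))).
move=> /subseq_uniq; apply; rewrite (map_comp (fun P => P 2) snd).
by rewrite -/unzip2 unzip2_zip// sl.
Qed.

(** Serves the case [m = d + 1], where the fifth orbit repeats the barycentre and the six second
    power sums are not distinct; the zero weight removes the repetition. *)
Lemma uniq_node_psums0 d p m a (l1 l2 l3 l4 l6 : rat) :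
  uniq [seq P 2 | P <- mask [:: true; true; true; true; false; true]
                         (node_psums d p m a)] ->
  uniq [seq q.2 2 | q <- zip [:: l1; l2; l3; l4; 0; l6] (node_psums d p m a)
                  & q.1 != 0].
Proof.
pose s := zip [:: l1; l2; l3; l4; l6]
  (mask [:: true; true; true; true; false; true] (node_psums d p m a)).
move=> u; rewrite (_ : [seq q <- _ | _] = [seq q <- s | q.1 != 0]); last first.
  by [].
have := map_subseq (fun q : rat * (nat -> rat) => q.2 2)
  (filter_subseq (fun q => q.1 != 0) s).
by move=> /subseq_uniq; apply.
Qed.

(** On the orbits of [v_k / k] one has [p_3 = p_2^2] and [p_4 = p_2 p_3], so two differences of
    moment equations involve the last weight alone. Their quotient reads
    [(a + 1) / (a + p) = 6 / (d + 5)], which is the origin of this value of [a]. *)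
Lemma acoord_ratr (R : realType) d p (a : rat) :
  6 * (p%:R - 1) / (d%:R - 1) - 1 = a -> acoord R d p = ratr a.
Proof.
move=> <-; rewrite rmorphB fmorph_div rmorphM /= !rmorphB /= !ratr_nat.
by rewrite (ratr_nat R 1) /acoord.
Qed.

Ltac weighted_field :=
  by apply: weighted_momentsI; cbv beta zeta; split; [|split| |]; field.
Ltac rat_ge0 := do 5 (apply/andP; split; [lra|]); lra.

Lemma valid_weights_d3 (R : realType) : valid_weights 3 3 4 (acoord R 3 3)
  (16 / 105) (1 / 70) (4 / 35) (81 / 350) 0 (256 / 525).
Proof.
rewrite (@acoord_ratr R 3 3 5); last by field.
apply: valid_weights_nodes; [by []|by []|by []|lra|rat_ge0|weighted_field|].
by apply: uniq_node_psums0; vm_compute.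
Qed.

(** The last weight follows from the equations for [p_3] and [p_2^2]. The other five solve a
    Vandermonde system in the distinct values [1/5, 1, 1/2, 1/3, 1/4] of [p_2]. *)
Lemma valid_weights_d4 (R : realType) : valid_weights 4 4 4 (acoord R 4 4)
  (625 / 8064) (1 / 144) (4 / 63) (9 / 56) (64 / 315) (2187 / 4480).
Proof.
rewrite (@acoord_ratr R 4 4 5); last by field.
apply: valid_weights_nodes; [by []|by []|by []|lra|rat_ge0|weighted_field|].
by apply: uniq_node_psums => //; vm_compute.
Qed.

(* Numerals are unary terms, hence the factored form of the larger weights. *)
Lemma valid_weights_d5 (R : realType) : valid_weights 5 4 4 (acoord R 5 4)
  (3 / 25) (79 / (2 * 8400)) (1 / 35) (3 / 35) (32 / 735) (1125 / 1568).
Proof.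
rewrite (@acoord_ratr R 5 4 (7 / 2)); last by field.
apply: valid_weights_nodes; [by []|by []|by []|lra|rat_ge0|weighted_field|].
by apply: uniq_node_psums => //; vm_compute.
Qed.

Lemma valid_weights_d6 (R : realType) : valid_weights 6 5 4 (acoord R 6 5)
  (833 / 8360) ((232 * 1000 + 891) / (8 * 1463 * 7875)) (1139 / (35 * 1463))
  (621 / (14 * 1463)) ((2 * 8032) / (63 * 1463)) ((176 * 1331) / (75 * 4655)).
Proof.
rewrite (@acoord_ratr R 6 5 (19 / 5)); last by field.
apply: valid_weights_nodes; [by []|by []|by []|lra|rat_ge0|weighted_field|].
by apply: uniq_node_psums => //; vm_compute.
Qed.

Lemma valid_weights_d7 (R : realType) : valid_weights 7 6 5 (acoord R 7 6)
  (2048 / (9 * 4455)) (41 / (6 * 4455)) (434 / (9 * 4455)) (7 / 110)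
  (1750 / 8019) (1750 / 2673).
Proof.
rewrite (@acoord_ratr R 7 6 4); last by field.
apply: valid_weights_nodes; [by []|by []|by []|lra|rat_ge0|weighted_field|].
by apply: uniq_node_psums => //; vm_compute.
Qed.

Lemma valid_weights_d8 (R : realType) : valid_weights 8 6 5 (acoord R 8 6)
  ((9 * 8829) / (256 * 5980)) ((167 * 677) / (8 * 2093 * 5760))
  (422 / (45 * 3289)) ((63 * 3697) / (1280 * 3289))
  ((25 * 8365) / (1536 * 9867)) ((1625 * 2197) / (768 * 5313)).
Proof.
rewrite (@acoord_ratr R 8 6 (23 / 7)); last by field.
apply: valid_weights_nodes; [by []|by []|by []|lra|rat_ge0|weighted_field|].
by apply: uniq_node_psums => //; vm_compute.
Qed.

Lemma valid_weights_d9 (R : realType) : valid_weights 9 7 5 (acoord R 9 7)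
  (1600 / (7 * 7007)) (2 / 2695) (8 / 2695) ((9 * 9693) / (350 * 7007))
  (2675 / (4 * 7007)) ((3 * 3969) / (2 * 7150)).
Proof.
rewrite (@acoord_ratr R 9 7 (7 / 2)); last by field.
apply: valid_weights_nodes; [by []|by []|by []|lra|rat_ge0|weighted_field|].
by apply: uniq_node_psums => //; vm_compute.
Qed.

Lemma valid_weights_d10 (R : realType) : valid_weights 10 8 5 (acoord R 10 8)
  ((11 * 2299) / (128 * 9828)) (595 / (256 * 5148)) (10 / 2079)
  (6075 / (64 * 8008)) ((125 * 5515) / (512 * 9009))
  ((125 * 8575) / (256 * 5148)).
Proof.
rewrite (@acoord_ratr R 10 8 (11 / 3)); last by field.
apply: valid_weights_nodes; [by []|by []|by []|lra|rat_ge0|weighted_field|].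
by apply: uniq_node_psums => //; vm_compute.
Qed.

(** Here the weights of the barycentre and of [v_3 / 3] vanish, which leaves four orbits. *)
Lemma valid_weights_d11 (R : realType) : valid_weights 11 11 6 (acoord R 11 11)
  0 (1 / 6825) (11 / 1365) 0 (891 / 2275) (4096 / 6825).
Proof.
rewrite (@acoord_ratr R 11 11 5); last by field.
apply: valid_weights_nodes; [by []|by []|by []|lra|rat_ge0|weighted_field|].
by apply: uniq_node_psums => //; vm_compute.
Qed.

Theorem mainTheorem5 (R : realType) :
  (forall d p m : nat,
     (d, p, m) \in [:: (3, 3, 4); (4, 4, 4); (5, 4, 4); (6, 5, 4); (7, 6, 5);
                       (8, 6, 5); (9, 7, 5); (10, 8, 5); (11, 11, 6)]%N ->
     exists l1 l2 l3 l4 l5 l6 : rat,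
       valid_weights d p m (acoord R d p) l1 l2 l3 l4 l5 l6)
  /\ (acoord R 3 3 = 5 /\
      valid_weights 3 3 4 (acoord R 3 3)
        (16 / 105) (1 / 70) (4 / 35) (81 / 350) 0 (256 / 525))
  /\ (acoord R 11 11 = 5 /\
      valid_weights 11 11 6 (acoord R 11 11)
        0 (1 / 6825) (11 / 1365) 0 (891 / 2275) (4096 / 6825)).
Proof.
split; [|split; split].
- move=> d p m; rewrite !inE.
  move=> /predU1P[[-> -> ->]|/predU1P[[-> -> ->]|/predU1P[[-> -> ->]|]]].
  + by do 6 eexists; exact: valid_weights_d3.
  + by do 6 eexists; exact: valid_weights_d4.
  + by do 6 eexists; exact: valid_weights_d5.
  move=> /predU1P[[-> -> ->]|/predU1P[[-> -> ->]|/predU1P[[-> -> ->]|]]].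
  + by do 6 eexists; exact: valid_weights_d6.
  + by do 6 eexists; exact: valid_weights_d7.
  + by do 6 eexists; exact: valid_weights_d8.
  move=> /predU1P[[-> -> ->]|/predU1P[[-> -> ->]|/eqP[-> -> ->]]].
  + by do 6 eexists; exact: valid_weights_d9.
  + by do 6 eexists; exact: valid_weights_d10.
  + by do 6 eexists; exact: valid_weights_d11.
- by rewrite /acoord; field.
- exact: valid_weights_d3.
- by rewrite /acoord; field.
- exact: valid_weights_d11.
Qed.
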